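(* For all positive integers $k$ and $n$, $$\varphi_k(n) = \varphi(n)^k \prod_{p\mid n} \left(1- \frac1{p-1}+\frac1{(p-1)^2}-\cdots +(-1)^{k-1} \frac1{(p-1)^{k-1}}\right) = n^k \prod_{p\mid n} \left(1-\frac1{p} \right) \left(\left(1-\frac{1}{p}\right)^k - \frac{(-1)^{k}}{p^k} \right),$$ where the products run over the primes $p$ dividing $n$.
   Context: $\varphi$ is Euler's totient function and $(a,b)$ denotes the greatest common divisor. For positive integers $k,n$, $\varphi_k(n)$ denotes the number of ordered $k$-tuples of integers $(a_1,\ldots,a_k)$ with $1\le a_1,\ldots,a_k\le n$ such that $(a_1\cdots a_k,n)=1$ and $(a_1+\cdots+a_k,n)=1$. The factor in the first product is $\sum_{i=0}^{k-1}(-1)^i/(p-1)^i$ (equal to $1$ when $k=1$). Empty products equal $1$. *)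

(* Defs.v *)
From mathcomp Require Import all_boot.

Set Implicit Arguments.
Unset Strict Implicit.
Unset Printing Implicit Defensive.

(* A k-tuple of integers in {1, ..., n} is a function into
   'I_n.+1 = {0, ..., n} none of whose values is 0. *)
Definition gen_totient (k n : nat) : nat :=
  #|[set a : {ffun 'I_k -> 'I_n.+1} |
      [&& [forall i, 0 < a i],
          coprime (\prod_(i < k) a i) n
        & coprime (\sum_(i < k) a i) n]]|.

(* Main.v *)
Require Import Defs.
From mathcomp Require Import all_boot all_order all_algebra.
From mathcomp Require Import ring.
Import GRing.Theory.
Local Open Scope ring_scope.

(** Both equalities are identities between multiplicative functions of [n], so
    it is enough to compare them at prime powers ([multiplicative_ext]).

    The counting function is multiplicative by the Chinese remainder theorem
    applied to each entry of the tuple ([gen_totientM]).  At a prime power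
    [p ^ e] the two coprimality conditions depend on the entries modulo [p]
    only, so the count is [p ^ (e - 1)] to the [k] times the count [c_k] at
    [p] ([gen_totient_pfactor]).

    At a prime [p], the [(p - 1) ^ (k + 1)] tuples of [k + 1] nonzero residues
    split into those with nonzero sum, which are [c_(k+1)] in number, and those
    with zero sum.  In the latter the first entry is the opposite of the sum of
    the others, and it is nonzero exactly when that sum is, so there are [c_k]
    of them.  Hence [c_(k+1) + c_k = (p - 1) ^ (k + 1)], with [c_0 = 0]
    ([tuple_count_primeS]).  Unrolling this recurrence and dividing by
    [(p - 1) ^ k] gives the alternating geometric sum ([tuple_count_prime]),
    whose closed form gives the second product ([alternating_geometric]). *)

(** * Counting tuples of residues *)

(** The values of a tuple are read as natural numbers, so that one predicate can
    be counted over several moduli. *)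
Definition tuple_count (k n : nat) (P : ('I_k -> nat) -> bool) : nat :=
  #|[set a : {ffun 'I_k -> 'I_n} | P (fun i => a i)]|.

(** Periodicity includes extensionality of [P], since [a] and [b] are only
    compared pointwise. *)
Definition periodic {k : nat} (m : nat) (P : ('I_k -> nat) -> bool) : Prop :=
  forall a b, (forall i, a i = b i %[mod m])%N -> P a = P b.

(** An injection between sets of equal size is bijective, and stays so when
    applied to every entry of a tuple. *)
Lemma tuple_count_prod (k m d : nat) (h1 : 'I_(m * d) -> 'I_m)
    (h2 : 'I_(m * d) -> 'I_d) (P Q R : ('I_k -> nat) -> bool) :
    injective (fun x => (h1 x, h2 x)) ->
    (forall a : {ffun 'I_k -> 'I_(m * d)},
      R (fun i => a i) = P (fun i => [ffun j => h1 (a j)] i)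
                      && Q (fun i => [ffun j => h2 (a j)] i)) ->
  tuple_count k (m * d) R = (tuple_count k m P * tuple_count k d Q)%N.
Proof.
move=> inj_h RPQ; rewrite /tuple_count -cardsX.
pose H (a : {ffun 'I_k -> 'I_(m * d)}) :=
  ([ffun j => h1 (a j)], [ffun j => h2 (a j)]).
have inj_H : injective H.
  move=> a b [/ffunP eq1 /ffunP eq2]; apply/ffunP=> i; apply: inj_h.
  by have := eq1 i; have := eq2 i; rewrite !ffunE => -> ->.
have bij_H : bijective H.
  apply: inj_card_bij inj_H _.
  by rewrite card_prod !card_ffun !card_ord expnMn.
rewrite -(on_card_preimset (onW_bij _ bij_H)).
by apply: eq_card => a; rewrite !inE /= RPQ.
Qed.

(** Euclidean division by [m] writes each of the [k] entries as a residue and an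
    unconstrained quotient. *)
Lemma tuple_count_scale (k m d : nat) (P : ('I_k -> nat) -> bool) :
    (0 < m)%N -> periodic m P ->
  tuple_count k (m * d) P = (tuple_count k m P * d ^ k)%N.
Proof.
move=> m_gt0 perP.
have ltq (x : 'I_(m * d)) : (x %/ m < d)%N.
  by rewrite ltn_divLR // (leq_trans (ltn_ord x)) // mulnC.
rewrite (@tuple_count_prod k m d (fun x => Ordinal (ltn_pmod x m_gt0))
           (fun x => Ordinal (ltq x)) P xpredT P).
- congr (_ * _)%N; rewrite /tuple_count.
  transitivity #|{ffun 'I_k -> 'I_d}|; last by rewrite card_ffun !card_ord.
  by apply: eq_card => a; rewrite !inE.
- move=> x y [eqr eqq]; apply: val_inj.
  by rewrite /= (divn_eq x m) (divn_eq y m) eqr eqq.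
- by move=> a; rewrite andbT; apply: perP => i; rewrite ffunE /= modn_mod.
Qed.

Lemma tuple_count_coprime (k m d : nat) (P Q : ('I_k -> nat) -> bool) :
    (0 < m)%N -> (0 < d)%N -> coprime m d -> periodic m P -> periodic d Q ->
  tuple_count k (m * d) (fun a => P a && Q a)
    = (tuple_count k m P * tuple_count k d Q)%N.
Proof.
move=> m_gt0 d_gt0 co_md perP perQ.
apply: (@tuple_count_prod k m d (fun x => Ordinal (ltn_pmod x m_gt0))
           (fun x => Ordinal (ltn_pmod x d_gt0))).
- move=> x y [/eqP eqm /eqP eqd]; apply: val_inj => /=.
  by apply/eqP; rewrite -(modn_small (ltn_ord x)) -(modn_small (ltn_ord y))
                        chinese_remainder // eqm eqd.
- by move=> a; congr (_ && _); [apply: perP | apply: perQ] => i;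
     rewrite ffunE /= modn_mod.
Qed.

(** Reduction modulo [n] only replaces the entries equal to [n] by [0]. *)
Lemma tuple_count_shift (k n : nat) (P : ('I_k -> nat) -> bool) :
    (0 < n)%N -> periodic n P ->
  #|[set a : {ffun 'I_k -> 'I_n.+1} | [forall i, 0 < a i]%N && P (fun i => a i)]|
    = tuple_count k n P.
Proof.
move=> n_gt0 perP; set A := [set a | _].
pose r (a : {ffun 'I_k -> 'I_n.+1}) := [ffun i => Ordinal (ltn_pmod (a i) n_gt0)].
have modE (x : 'I_n.+1) :
    (0 < x)%N -> nat_of_ord x = (if x %% n == 0 then n else x %% n)%N.
  move=> x_gt0; have := ltn_ord x; rewrite ltnS leq_eqVlt => /predU1P[-> | lt_xn].
    by rewrite modnn.
  by rewrite modn_small // eqn0Ngt x_gt0.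
have inj_r : {in A &, injective r}.
  move=> a b; rewrite !inE => /andP[/forallP a_gt0 _] /andP[/forallP b_gt0 _].
  move=> /ffunP eq_r; apply/ffunP=> i; apply: val_inj => /=.
  have := congr1 val (eq_r i); rewrite !ffunE /= => eq_i.
  by rewrite (modE _ (a_gt0 i)) (modE _ (b_gt0 i)) eq_i.
rewrite -(card_in_imset inj_r) /tuple_count; apply: eq_card => b.
rewrite [RHS]inE; apply/imsetP/idP => [[a + ->] | Pb].
  rewrite inE => /andP[_ Pa]; rewrite (perP _ (fun i => a i)) // => i.
  by rewrite ffunE /= modn_mod.
have lt_b i : ((if b i == 0 :> nat then n else b i) < n.+1)%N.
  by case: ifP => // _; rewrite ltnS ltnW.
have mod_b i : ((if b i == 0 :> nat then n else b i) = b i %[mod n])%N.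
  by case: eqP => // ->; rewrite modnn mod0n.
exists [ffun i => Ordinal (lt_b i)].
  rewrite inE; apply/andP; split.
    by apply/forallP=> i; rewrite ffunE /=; case: ifP => //; rewrite lt0n => ->.
  by rewrite (perP _ (fun i => b i)) // => i; rewrite ffunE /=.
by apply/ffunP=> i; apply: val_inj; rewrite !ffunE /= mod_b modn_small.
Qed.

(** * The coprimality condition *)

Definition good (k n : nat) (a : 'I_k -> nat) : bool :=
  coprime (\prod_(i < k) a i) n && coprime (\sum_(i < k) a i) n.

Lemma periodic_good (k n : nat) : periodic n (good k n).
Proof.
move=> a b eq_ab; rewrite /good; congr (_ && _).
- rewrite -coprime_modl -[RHS]coprime_modl; congr coprime.
  apply: (big_ind2 (fun x y => x = y %[mod n])%N) => // x1 x2 y1 y2 eqx eqy.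
  by rewrite -modnMm eqx eqy modnMm.
- rewrite -coprime_modl -[RHS]coprime_modl; congr coprime.
  apply: (big_ind2 (fun x y => x = y %[mod n])%N) => // x1 x2 y1 y2 eqx eqy.
  by rewrite -modnDm eqx eqy modnDm.
Qed.

Lemma gen_totientE (k n : nat) :
  (0 < n)%N -> gen_totient k n = tuple_count k n (good k n).
Proof. by move=> n_gt0; rewrite -tuple_count_shift //; apply: periodic_good. Qed.

Lemma gen_totientM (k m d : nat) : (0 < m)%N -> (0 < d)%N -> coprime m d ->
  gen_totient k (m * d) = (gen_totient k m * gen_totient k d)%N.
Proof.
move=> m_gt0 d_gt0 co_md; rewrite !gen_totientE ?muln_gt0 ?m_gt0 //.
rewrite -tuple_count_coprime //; try exact: periodic_good.
apply: eq_card => a; rewrite !inE /good !coprimeMr.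
by rewrite andbACA.
Qed.

Lemma good_pfactor (k p e : nat) (a : 'I_k -> nat) :
  good k (p ^ e.+1) a = good k p a.
Proof. by rewrite /good !coprime_pexpr. Qed.

Lemma gen_totient_pfactor (k p e : nat) : prime p ->
  gen_totient k (p ^ e.+1) = (tuple_count k p (good k p) * (p ^ e) ^ k)%N.
Proof.
move=> p_pr; rewrite gen_totientE ?expn_gt0 ?prime_gt0 // expnS.
rewrite -tuple_count_scale ?prime_gt0 //; last exact: periodic_good.
by apply: eq_card => a; rewrite !inE -(good_pfactor k p e) expnS.
Qed.

(** * The count at a prime *)

Lemma coprime_prod_all (k n : nat) (a : 'I_k -> nat) :
  coprime (\prod_(i < k) a i) n = [forall i, coprime (a i) n].
Proof.
rewrite (big_morph (coprime^~ n) (coprimeMl n) (coprime1n n)) big_andE.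
by apply: eq_forallb.
Qed.

Lemma card_unit_tuples (k n : nat) :
  #|[set a : {ffun 'I_k -> 'I_n} | [forall i, coprime (a i) n]]|
    = (totient n ^ k)%N.
Proof.
have -> : totient n = #|[pred x : 'I_n | coprime x n]|.
  rewrite totient_count_coprime big_mkord -sum1_card big_mkcond [RHS]big_mkcond /=.
  by apply: eq_bigr => i _; rewrite !inE coprime_sym; case: coprime.
transitivity #|[pred a : {ffun 'I_k -> 'I_n} |
                 a \in ffun_on [pred x : 'I_n | coprime x n]]|.
  by apply: eq_card => a; rewrite inE; apply: eq_forallb.
by rewrite card_ffun_on card_ord.
Qed.

(** Forgetting the first entry is a bijection from the tuples of [k.+1] nonzero
    residues with zero sum to the tuples of [k] nonzero residues with nonzero
    sum. *)
Lemma card_unit_tuples_sum0 (k p : nat) : prime p ->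
  #|[set a : {ffun 'I_k.+1 -> 'I_p} |
      [forall i, coprime (a i) p] && ~~ coprime (\sum_(i < k.+1) a i) p]|
    = tuple_count k p (good k p).
Proof.
move=> p_pr; have p_gt0 := prime_gt0 p_pr.
have coE x : coprime x p = ~~ (p %| x)%N by rewrite coprime_sym prime_coprime.
set A := [set a | _].
pose tl (a : {ffun 'I_k.+1 -> 'I_p}) := [ffun i : 'I_k => a (lift ord0 i)].
have memA a : a \in A ->
    [/\ forall i, ~~ (p %| a i)%N & (p %| a ord0 + \sum_(i < k) tl a i)%N].
  rewrite inE coE negbK => /andP[/forallP co_a]; rewrite big_ord_recl => dv_a.
  split=> [i | ]; first by rewrite -coE.
  by under eq_bigr do rewrite ffunE.
have inj_tl : {in A &, injective tl}.
  move=> a b /memA[_ dv_a] /memA[_ dv_b] eq_tl.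
  have eq0 : a ord0 = b ord0.
    apply: val_inj; rewrite /= -(modn_small (ltn_ord (a _))).
    rewrite -[RHS](modn_small (ltn_ord (b _))); apply/eqP.
    rewrite -(eqn_modDr (\sum_(i < k) tl a i)) {2}eq_tl.
    by rewrite /= (eqP dv_a) (eqP dv_b).
  apply/ffunP=> i; case: (unliftP ord0 i) => [j | ] -> //.
  by have /ffunP/(_ j) := eq_tl; rewrite !ffunE.
rewrite -(card_in_imset inj_tl) /tuple_count; apply: eq_card => b.
rewrite [RHS]inE /good coprime_prod_all; apply/imsetP/idP.
  move=> [a /memA[co_a dv_a] ->]; apply/andP; split.
    by apply/forallP=> i; rewrite ffunE coE.
  rewrite coE; apply: contra (co_a ord0) => dv_s.
  by rewrite -(dvdn_addl _ dv_s).
move=> /andP[/forallP co_b]; rewrite coE => ndv_s.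
set s := (\sum_(i < k) b i)%N in ndv_s.
have lt_x : ((p - s %% p) < p)%N.
  by rewrite ltn_subrL p_gt0 andbT lt0n.
have dv_xs : (p %| p - s %% p + s)%N.
  by rewrite /dvdn -modnDmr subnK ?modnn // ltnW ?ltn_pmod.
pose a := [ffun i => if unlift ord0 i is Some j then b j else Ordinal lt_x].
have a0 : a ord0 = Ordinal lt_x by rewrite ffunE unlift_none.
have aS j : a (lift ord0 j) = b j by rewrite ffunE liftK.
exists a; last by apply/ffunP=> i; rewrite ffunE aS.
rewrite inE; apply/andP; split.
  apply/forallP=> i; case: (unliftP ord0 i) => [j | ] ->; first by rewrite aS.
  by rewrite a0 coE; apply: contra ndv_s => /= dv_x; rewrite -(dvdn_addr _ dv_x).
rewrite coE negbK big_ord_recl a0.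
by under eq_bigr do rewrite aS.
Qed.

Lemma tuple_count_primeS (k p : nat) : prime p ->
  (tuple_count k.+1 p (good k.+1 p) + tuple_count k p (good k p)
    = p.-1 ^ k.+1)%N.
Proof.
move=> p_pr; rewrite -(totient_prime p_pr) -card_unit_tuples.
rewrite -(card_unit_tuples_sum0 k p p_pr).
rewrite -(cardsID [set a : {ffun 'I_k.+1 -> 'I_p} |
                    coprime (\sum_(i < k.+1) a i) p]
                  [set a : {ffun 'I_k.+1 -> 'I_p} | [forall i, coprime (a i) p]]).
by congr (_ + _)%N; apply: eq_card => a;
  rewrite !inE /good ?coprime_prod_all // andbC.
Qed.

Lemma natr_pred_prime (p : nat) : prime p -> p.-1%:R = p%:R - 1 :> rat.
Proof. by move=> p_pr; rewrite -subn1 natrB ?prime_gt0. Qed.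

Lemma pred_prime_neq0 (p : nat) : prime p -> p%:R - 1 != 0 :> rat.
Proof.
move=> p_pr; rewrite -natr_pred_prime // Num.Theory.pnatr_eq0 -lt0n.
by rewrite -subn1 subn_gt0 prime_gt1.
Qed.

Lemma tuple_count_prime (k p : nat) : prime p ->
  (tuple_count k p (good k p))%:R =
    (p%:R - 1) ^+ k * \sum_(i < k) (-1) ^+ i / (p%:R - 1) ^+ i :> rat.
Proof.
move=> p_pr; have q_neq0 := pred_prime_neq0 p p_pr; elim: k => [ | k IHk].
  (* the empty sum is 0, which is not coprime to [p] *)
  rewrite big_ord0 mulr0 /tuple_count (_ : [set _ | _] = set0) ?cards0 //.
  apply/setP=> a; rewrite !inE /good !big_ord0 /coprime gcd0n.
  by rewrite (gtn_eqF (prime_gt1 p_pr)) andbF.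
have := congr1 (fun m => m%:R : rat) (tuple_count_primeS k p p_pr).
rewrite natrD natrX natr_pred_prime // IHk => /(canRL (addrK _)) ->.
rewrite big_ord_recl expr0 divr1 mulrDr mulr1; congr (_ + _).
rewrite -mulrN -sumrN exprSr -mulrA; congr (_ * _); rewrite mulr_sumr.
apply: eq_bigr => i _; rewrite lift0 !exprS; field.
by rewrite expf_neq0.
Qed.

(** * Multiplicative functions *)

Definition multiplicative_fun (f : nat -> rat) : Prop :=
  f 1%N = 1 /\ forall m d, (0 < m)%N -> (0 < d)%N -> coprime m d ->
                 f (m * d)%N = f m * f d.

(** Splitting off the full power of the smallest prime factor leaves a smaller
    coprime cofactor. *)
Lemma multiplicative_ext (f g : nat -> rat) :
    multiplicative_fun f -> multiplicative_fun g ->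
    (forall p e, prime p -> f (p ^ e.+1)%N = g (p ^ e.+1)%N) ->
  forall n, (0 < n)%N -> f n = g n.
Proof.
move=> [f1 fM] [g1 gM] fg_pfactor; elim/ltn_ind => n IHn n_gt0.
have [n_le1 | n_gt1] := leqP n 1.
  by rewrite (_ : n = 1%N) ?f1 ?g1 //; apply/eqP; rewrite eqn_leq n_le1.
have p_pr := pdiv_prime n_gt1; set p := pdiv n in p_pr.
have [m co_pm defn] := pfactor_coprime p_pr n_gt0.
have /prednK defe : (0 < logn p n)%N.
  by rewrite logn_gt0 mem_primes p_pr n_gt0 pdiv_dvd.
have m_gt0 : (0 < m)%N by move: n_gt0; rewrite {1}defn muln_gt0 => /andP[].
have q_gt0 : (0 < p ^ logn p n)%N by rewrite expn_gt0 prime_gt0.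
have lt_mn : (m < n)%N.
  rewrite {1}defn ltn_Pmulr // -defe -{1}(exp1n (logn p n).-1.+1).
  by rewrite ltn_exp2r ?prime_gt1.
have co_mq : coprime m (p ^ logn p n) by rewrite coprime_sym coprimeXl.
by rewrite defn fM // gM // IHn // -defe fg_pfactor.
Qed.

Lemma multiplicative_gen_totient (k : nat) :
  multiplicative_fun (fun n => (gen_totient k n)%:R).
Proof.
split=> [ | m d m_gt0 d_gt0 co_md]; last by rewrite gen_totientM // natrM.
rewrite gen_totientE // /tuple_count.
rewrite (_ : [set _ | _] = setT); first by rewrite cardsT card_ffun !card_ord exp1n.
by apply/setP=> a; rewrite !inE /good !coprimen1.
Qed.

(** Coprime numbers have disjoint lists of prime divisors, so that the
    concatenation of these lists has no repetition. *)
Lemma prod_primesM (F : nat -> rat) (m d : nat) :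
    (0 < m)%N -> (0 < d)%N -> coprime m d ->
  \prod_(p <- primes (m * d)) F p
    = (\prod_(p <- primes m) F p) * \prod_(p <- primes d) F p.
Proof.
move=> m_gt0 d_gt0 co_md; rewrite -big_cat /=; apply: perm_big.
apply: uniq_perm; rewrite ?primes_uniq //.
  by rewrite cat_uniq !primes_uniq -coprime_has_primes ?co_md.
by move=> p; rewrite mem_cat primesM.
Qed.

Lemma multiplicative_exp_prod (h : nat -> nat) (F : nat -> rat) (k : nat) :
    h 1%N = 1%N ->
    (forall m d, coprime m d -> h (m * d)%N = (h m * h d)%N) ->
  multiplicative_fun (fun n => (h n)%:R ^+ k * \prod_(p <- primes n) F p).
Proof.
move=> h1 hM; split=> [ | m d m_gt0 d_gt0 co_md].
  by rewrite h1 expr1n big_nil mulr1.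
by rewrite prod_primesM // hM // natrM exprMn mulrACA.
Qed.

Lemma prod_primes_pfactor (F : nat -> rat) (p e : nat) : prime p ->
  \prod_(q <- primes (p ^ e.+1)) F q = F p.
Proof. by move=> p_pr; rewrite primesX // primes_prime // big_seq1. Qed.

(** The sum is geometric of ratio [- 1 / x], where [x = p - 1] for a prime
    divisor [p] of [n]. *)
Lemma alternating_geometric (x : rat) (k : nat) : x != 0 -> x + 1 != 0 ->
  x ^+ k * \sum_(i < k) (-1) ^+ i / x ^+ i
    = (x / (x + 1)) * (x ^+ k - (-1) ^+ k).
Proof.
move=> x_neq0 x1_neq0; elim: k => [ | k IHk].
  by rewrite big_ord0 !expr0 subrr !mulr0.
rewrite big_ord_recr /= mulrDr {1}exprS -mulrA IHk !exprS; field.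
by rewrite x1_neq0 expf_neq0.
Qed.

Theorem theorem2p1 (k n : nat) (hk : (0 < k)%N) (hn : (0 < n)%N) :
  (gen_totient k n)%:R =
    (totient n)%:R ^+ k *
      \prod_(p <- primes n) \sum_(i < k) (-1) ^+ i / (p%:R - 1) ^+ i :> rat
  /\
  (totient n)%:R ^+ k *
      \prod_(p <- primes n) \sum_(i < k) (-1) ^+ i / (p%:R - 1) ^+ i =
    n%:R ^+ k *
      \prod_(p <- primes n)
        ((1 - 1 / p%:R) * ((1 - 1 / p%:R) ^+ k - (-1) ^+ k / p%:R ^+ k)) :> rat.
Proof.
have mult_phi (F : nat -> rat) := @multiplicative_exp_prod totient F k
  (erefl : totient 1 = 1%N) totient_coprime.
split.
  apply: (multiplicative_ext _ _ (multiplicative_gen_totient k) (mult_phi _)) hn.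
  move=> p e p_pr; rewrite prod_primes_pfactor // totient_pfactor //.
  rewrite gen_totient_pfactor // !natrM tuple_count_prime // natr_pred_prime //.
  by rewrite exprMn [LHS]mulrAC !natrX.
apply: (multiplicative_ext _ _ (mult_phi _)
         (@multiplicative_exp_prod id _ k erefl _)) hn => // p e p_pr.
rewrite !prod_primes_pfactor // totient_pfactor // natrM natr_pred_prime //.
have q_neq0 := pred_prime_neq0 p p_pr.
have p_neq0 : p%:R != 0 :> rat by rewrite Num.Theory.pnatr_eq0 -lt0n prime_gt0.
have {1}-> : p%:R = (p%:R - 1) + 1 :> rat by rewrite subrK.
rewrite addrK exprMn [LHS]mulrAC alternating_geometric // ?subrK //.
rewrite (_ : 1 - 1 / p%:R = (p%:R - 1) / p%:R); last by field.
rewrite expnS natrM !exprMn exprVn; field.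
by rewrite p_neq0 expf_neq0.
Qed.
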